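(* Let $r,s,t,u\in\mathbb{R}\setminus\{0\}$ with $|s/r|<1$ and $|u/t|<1$. Then the $\alpha$-dual of $B[\mathcal{C}_f]$ is $\mathcal{L}_u$, i.e. $\{B[\mathcal{C}_f]\}^{\alpha}=\mathcal{L}_u$.
   Context: $\mathbb{N}=\{0,1,2,\dots\}$; $\Omega$ is the vector space of all complex double sequences $x=(x_{kl})_{k,l\in\mathbb{N}}$. ''$p$-$\lim$'' denotes the limit in Pringsheim's sense (both indices tend to infinity independently). $\mathcal{L}_u=\{x\in\Omega:\sum_{k,l}|x_{kl}|<\infty\}$. The $\alpha$-dual of $\lambda\subset\Omega$ is $\lambda^\alpha=\{a\in\Omega: (a_{kl}x_{kl})\in\mathcal{L}_u \text{ for all } x\in\lambda\}$. $[\mathcal{C}_f]$ (strongly almost convergent double sequences) is the set of $x\in\Omega$ for which there is $L\in\mathbb{C}$ with $$p\text{-}\lim_{q,q'\to\infty}\ \sup_{m,n\in\mathbb{N}}\frac{1}{(q+1)(q'+1)}\sum_{k=m}^{m+q}\sum_{l=n}^{n+q'}|x_{kl}-L|=0.$$ For $r,s,t,u\in\mathbb{R}\setminus\{0\}$, the generalized difference matrix $B=B(r,s,t,u)$ acts by $(Bx)_{mn}=su\,x_{m-1,n-1}+st\,x_{m-1,n}+ru\,x_{m,n-1}+rt\,x_{mn}$, where terms with a negative index are $0$. $B[\mathcal{C}_f]=\{x\in\Omega: Bx\in[\mathcal{C}_f]\}$. *)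

(* Defs.v *)
From mathcomp Require Import all_boot all_order all_algebra.
From mathcomp Require Import all_classical all_reals all_analysis.
From mathcomp Require Import complex.

Set Implicit Arguments.
Unset Strict Implicit.
Unset Printing Implicit Defensive.

Import Order.TTheory GRing.Theory Num.Theory.
Import numFieldNormedType.Exports.

Local Open Scope classical_set_scope.
Local Open Scope ring_scope.
Local Open Scope complex_scope.

Definition dseq (R : realType) := nat -> nat -> R[i].

(* The modulus taken in R: the norm [`|z|] of [R[i]] is again in [R[i]]. *)
Definition cabs (R : realType) (z : R[i]) : R := ComplexField.Normc.normc z.

(* Pringsheim's limit: both indices go to infinity independently. *)
Definition pringsheim_cvg (T : topologicalType) (x : nat -> nat -> T) (l : T) :=
  x mn.1 mn.2 @[mn --> (\oo, \oo)] --> l.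

Definition Lu (R : realType) : set (dseq R) :=
  [set x | summable [set: nat * nat] (fun kl => (cabs (x kl.1 kl.2))%:E)].

Definition alpha_dual (R : realType) (lambda : set (dseq R)) : set (dseq R) :=
  [set a | forall x, lambda x -> Lu (fun k l => a k l * x k l)].

Definition window_mean (R : realType) (x : dseq R) (L : R[i])
    (q q' m n : nat) : R :=
  (q.+1%:R * q'.+1%:R)^-1 *
  \sum_(m <= k < (m + q).+1) \sum_(n <= l < (n + q').+1) cabs (x k l - L).

(* The supremum is taken in [\bar R], as it may be infinite. *)
Definition sup_window_mean (R : realType) (x : dseq R) (L : R[i])
    (q q' : nat) : \bar R :=
  ereal_sup [set (window_mean x L q q' mn.1 mn.2)%:E | mn in [set: nat * nat]].

Definition strongly_almost_cvg (R : realType) : set (dseq R) :=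
  [set x | exists L : R[i], pringsheim_cvg (sup_window_mean x L) 0%E].

Definition pred_row (R : realType) (x : dseq R) : dseq R :=
  fun m n => if m is m'.+1 then x m' n else 0.

Definition pred_col (R : realType) (x : dseq R) : dseq R :=
  fun m n => if n is n'.+1 then x m n' else 0.

Definition gen_diff (R : realType) (r s t u : R) (x : dseq R) : dseq R :=
  fun m n =>
    (s * u)%:C * pred_row (pred_col x) m n + (s * t)%:C * pred_row x m n
    + (r * u)%:C * pred_col x m n + (r * t)%:C * x m n.

Definition B_domain (R : realType) (r s t u : R) (lambda : set (dseq R)) :
    set (dseq R) :=
  [set x | lambda (gen_diff r s t u x)].

(* Main.v *)
(* A strongly almost convergent sequence has a finite supremum of window means
   for some window size, hence is bounded. As |s/r|, |u/t| < 1, boundedness of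
   Bx forces that of x (solve one first-order recurrence in each index), so
   L_u is contained in the dual. Conversely the sequence
   (1 - (-s/r)^(m+1)) (1 - (-u/t)^(n+1)) is bounded away from 0 and has constant
   image under B, so testing the dual against it yields L_u. *)
Require Import Defs.
From mathcomp Require Import all_boot all_order all_algebra.
From mathcomp Require Import all_classical all_reals all_analysis.
From mathcomp Require Import complex ring.

Import Order.TTheory GRing.Theory Num.Theory.
Local Open Scope classical_set_scope.
Local Open Scope ring_scope.

Lemma cabs_ge0 {R : realType} (z : R[i]) : 0 <= cabs z.
Proof. by case: z => a b; exact: sqrtr_ge0. Qed.

Lemma cabsM {R : realType} (z w : R[i]) : cabs (z * w) = cabs z * cabs w.
Proof. exact: ComplexField.Normc.normcM. Qed.

Lemma cabsD {R : realType} (z w : R[i]) : cabs (z + w) <= cabs z + cabs w.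
Proof. exact: le_normcD. Qed.

Lemma cabs_real {R : realType} (a : R) : cabs (a%:C)%C = `|a|.
Proof. by rewrite /cabs /= expr0n addr0 sqrtr_sqr. Qed.

(** Comparison test: the factor [c] passes through every finite partial sum, hence to the supremum
    of these sums. *)
Lemma summable_le_scale {R : realType} {T : choiceType} {D : set T}
    {c : R} {f g : T -> R} :
  0 <= c -> (forall i, D i -> `|f i| <= c * `|g i|) ->
  summable D (EFin \o g) -> summable D (EFin \o f).
Proof.
move=> c0 fg sg; rewrite /summable /=.
apply: (@le_lt_trans _ _ (c%:E * \esum_(i in D) `|(g i)%:E|)%E); last first.
  move: sg; rewrite summableE => sg.
  by rewrite lte_mul_pinfty ?lee_fin // -ge0_fin_numE ?esum_ge0.
apply: ge_ereal_sup => _ [A [finA AD] <-].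
apply: (@le_trans _ _ (c%:E * \sum_(i \in A) `|(g i)%:E|)%E); last first.
  by apply: lee_wpmul2l; rewrite ?lee_fin //; apply: esum_ge; exists A.
rewrite ge0_mule_fsumr //; apply: lee_fsum => // i Ai.
by rewrite /= lee_fin fg //; exact: AD.
Qed.

(* The bound [M / (|a| - |b|)] is the fixed point of
   [K |-> (M + |b| K) / |a|]. *)
Lemma first_order_bound {R : realType} {a b M : R} {v : nat -> R[i]} :
  `|b| < `|a| ->
  (forall n, cabs ((a%:C)%C * v n + (b%:C)%C * (if n is n'.+1 then v n' else 0))
             <= M) ->
  forall n, cabs (v n) <= M / (`|a| - `|b|).
Proof.
move=> ba vM; have d0 : 0 < `|a| - `|b| by rewrite subr_gt0.
have a0 : 0 < `|a| by exact: le_lt_trans ba.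
have M0 : 0 <= M by apply: le_trans (vM 0); exact: cabs_ge0.
set K := M / _; have K0 : 0 <= K by rewrite divr_ge0 // ltW.
have KE : M + `|b| * K = `|a| * K by rewrite /K; field; rewrite gt_eqF.
elim=> [|n IHn]; rewrite -(ler_pM2l a0) -cabs_real -cabsM.
  have := vM 0; rewrite mulr0 addr0 cabs_real => /le_trans; apply.
  by rewrite -KE lerDl mulr_ge0.
(* Moving the shifted term across bounds [|a| |v n.+1|] by [M + |b| K], which is [|a| K]. *)
have -> : (a%:C)%C * v n.+1 =
    ((a%:C)%C * v n.+1 + (b%:C)%C * v n) + ((- b)%:C)%C * v n.
  by rewrite rmorphN mulNr addrK.
apply: (le_trans (cabsD _ _)); rewrite !cabsM !cabs_real normrN -KE.
by rewrite lerD ?ler_wpM2l ?(vM n.+1).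
Qed.

Lemma gen_diff_bound {R : realType} {r s t u M : R} {x : dseq R} :
  `|s| < `|r| -> `|u| < `|t| ->
  (forall m n, cabs (gen_diff r s t u x m n) <= M) ->
  forall m n, cabs (x m n) <= M / (`|r| - `|s|) / (`|t| - `|u|).
Proof.
move=> sr ut xM m n.
apply: (first_order_bound ut (v := x m)) => {}n.
(* [B] factors into a first-order operator in each index: [z] is the column factor at fixed [n], and
   the row factor applied to [z] gives [gen_diff]. *)
pose z k := (t%:C)%C * x k n + (u%:C)%C * (if n is n'.+1 then x k n' else 0).
apply: (first_order_bound sr (v := z)) => {}m.
have -> // : (r%:C)%C * z m + (s%:C)%C * (if m is m'.+1 then z m' else 0) =
  gen_diff r s t u x m n.
rewrite /gen_diff /z {z} !rmorphM /pred_row /pred_col.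
by case: m n => [|m] [|n]; ring.
Qed.

(** The entry at [(m, n)] is the corner term of its window, and the other terms are nonnegative. *)
Lemma le_sup_window_mean {R : realType} (x : dseq R) (L : R[i])
    (q q' m n : nat) :
  ((cabs (x m n - L) / (q.+1%:R * q'.+1%:R))%:E <= sup_window_mean x L q q')%E.
Proof.
apply: (@le_trans _ _ (window_mean x L q q' m n)%:E); last first.
  by apply: ereal_sup_ubound; exists (m, n).
rewrite lee_fin /window_mean mulrC ler_wpM2l ?invr_ge0 ?mulr_ge0 //.
rewrite big_ltn ?ltnS ?leq_addr //
  [X in _ <= X + _]big_ltn ?ltnS ?leq_addr // -addrA lerDl.
by rewrite addr_ge0 // ?sumr_ge0 // => *; rewrite ?sumr_ge0 // => *;
  exact: cabs_ge0.
Qed.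

Lemma strongly_almost_cvg_bounded {R : realType} {x : dseq R} :
  strongly_almost_cvg x -> exists M, forall m n, cabs (x m n) <= M.
Proof.
move=> [L xL].
(* Tolerance 1 suffices: one window size [(N, N')] with supremum below 1 bounds every
   [cabs (x m n - L)] by the area of the window. *)
have /xL : nbhs (0%E : \bar R) [set y | (y < 1%:E)%E].
  apply: open_nbhs_nbhs; split; last by rewrite /= lte_fin.
  exact: open_ereal_lt_ereal.
move=> [[A B] [[N _ NA] [N' _ NB]] AB].
exists (N.+1%:R * N'.+1%:R + cabs L) => m n.
rewrite -[x m n](subrK L); apply: (le_trans (cabsD _ _)); rewrite lerD2r.
have /= /ltW := AB (N, N') (conj (NA N (leqnn _)) (NB N' (leqnn _))).
move=> /(le_trans (le_sup_window_mean x L N N' m n)).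
by rewrite lee_fin ler_pdivrMr ?mulr_gt0 // mul1r.
Qed.

Lemma strongly_almost_cvg_cst {R : realType} (L : R[i]) :
  strongly_almost_cvg (fun _ _ => L).
Proof.
exists L; rewrite /pringsheim_cvg.
have -> : (fun mn : nat * nat => sup_window_mean (fun _ _ => L) L mn.1 mn.2) =
          cst 0%E; last exact: cvg_cst.
apply/funext => -[q q'] /=; rewrite /sup_window_mean.
rewrite (_ : [set _ | _ in _] = [set 0%E]) ?ereal_sup1 //.
have w0 m n : window_mean (fun _ _ => L) L q q' m n = 0.
  rewrite /window_mean big1 ?mulr0 // => k _; rewrite big1 // => l _.
  by rewrite subrr /cabs ComplexField.Normc.normc0.
apply/seteqP; split=> [_ [mn _ <-]|_ ->]; first by rewrite w0.
by exists (0%N, 0%N) => //; rewrite w0.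
Qed.

(* Partial sums of the geometric series solving [r p_m + s p_(m-1) = r + s],
   up to a nonzero factor. *)
Definition geom_seq {R : realType} (r s : R) (m : nat) : R :=
  1 - (- (s / r)) ^+ m.+1.

(** Reverse triangle inequality, with [|s / r| ^+ m.+1] at most [|s / r|]. *)
Lemma geom_seq_ge {R : realType} (r s : R) (m : nat) :
  `|s / r| < 1 -> 1 - `|s / r| <= `|geom_seq r s m|.
Proof.
move=> sr; rewrite /geom_seq; apply: le_trans (lerB_dist _ _).
rewrite normr1 lerB // normrX normrN exprS ler_piMr //.
by rewrite exprn_ile1 // ltW.
Qed.

(** In each index the powers cancel, leaving [r + s] and [t + u]; this also holds at index 0, where
    the missing predecessor agrees with [1 - (- (s / r)) ^+ 0 = 0]. *)
Lemma gen_diff_geom {R : realType} (r s t u : R) : r != 0 -> t != 0 ->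
  gen_diff r s t u (fun m n => ((geom_seq r s m * geom_seq t u n)%:C)%C) =
  fun _ _ => (((r + s) * (t + u))%:C)%C.
Proof.
move=> r0 t0; apply/funext => m; apply/funext => n.
rewrite /gen_diff /pred_row /pred_col /geom_seq.
case: m n => [|m] [|n]; rewrite ?mulr0 ?add0r -?rmorphM -?rmorphD /=;
  congr (_%:C)%C; rewrite ?exprS ?expr0; field; rewrite ?r0 ?t0 //.
Qed.

Theorem theorem4p1 (R : realType) (r s t u : R)
  (hr : r != 0) (hs : s != 0) (ht : t != 0) (hu : u != 0)
  (hsr : `|s / r| < 1) (hut : `|u / t| < 1) :
  alpha_dual (B_domain r s t u (@strongly_almost_cvg R)) = @Lu R.
Proof.
have sr : `|s| < `|r|.
  by move: hsr; rewrite normf_div ltr_pdivrMr ?normr_gt0 // mul1r.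
have ut : `|u| < `|t|.
  by move: hut; rewrite normf_div ltr_pdivrMr ?normr_gt0 // mul1r.
apply/seteqP; split=> [a aB|a aL x /strongly_almost_cvg_bounded[M xM]].
- pose x m n := ((geom_seq r s m * geom_seq t u n)%:C)%C.
  have xB : B_domain r s t u (@strongly_almost_cvg R) x.
    by rewrite /B_domain /= gen_diff_geom //; exact: strongly_almost_cvg_cst.
  (* [c] is a positive lower bound for the moduli of [x], so [|a|] is at most [c^-1 |a x|]
     entrywise. *)
  pose c := (1 - `|s / r|) * (1 - `|u / t|).
  have c0 : 0 < c by rewrite mulr_gt0 // subr_gt0.
  apply: (summable_le_scale (c := c^-1) _ _ (aB x xB)) => [|[k l] _].
    by rewrite invr_ge0 ltW.
  rewrite /= !(ger0_norm (cabs_ge0 _)) mulrC ler_pdivlMr // cabsM.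
  rewrite ler_wpM2l ?cabs_ge0 // cabs_real normrM.
  by rewrite ler_pM ?geom_seq_ge // subr_ge0 ltW.
- have {}xM := gen_diff_bound sr ut xM.
  apply: (summable_le_scale _ _ aL) => [|[k l] _].
    exact: le_trans (cabs_ge0 _) (xM 0 0).
  rewrite /= !(ger0_norm (cabs_ge0 _)) cabsM mulrC.
  by rewrite ler_wpM2r ?cabs_ge0.
Qed.
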